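(* Let $\mathcal{A} = (X,Y,Z)\cdot\mathcal{C} \in \mathbb{R}^{l\times m\times n}$ with multilinear rank $\operatorname{rank}(\mathcal{A}) = (r,r,r)$, where $\mathcal{C}\in\mathbb{R}^{r\times r\times r}$ and $X\in\mathbb{R}^{l\times r}$, $Y\in\mathbb{R}^{m\times r}$, $Z\in\mathbb{R}^{n\times r}$ have full column rank. Assume that the starting vectors lie in the associated range spaces, i.e. $u_1\in\operatorname{span}(X)$, $v_1\in\operatorname{span}(Y)$, $w_1\in\operatorname{span}(Z)$. Assume also that the minimal Krylov recursion applied to $\mathcal{A}$ does not break down within $r$ iterations. Then the minimal Krylov recursion generates matrices $U_r=[u_1\,\cdots\,u_r]$, $V_r=[v_1\,\cdots\,v_r]$, $W_r=[w_1\,\cdots\,w_r]$ with $$\operatorname{span}(U_r)=\operatorname{span}(X),\qquad \operatorname{span}(V_r)=\operatorname{span}(Y),\qquad \operatorname{span}(W_r)=\operatorname{span}(Z).$$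
   Context: All tensors are real arrays of order three, and $\operatorname{span}(M)$ of a matrix $M$ denotes its column space. Tensor-matrix multiplication: for $\mathcal{C}\in\mathbb{R}^{p\times q\times r}$ and $X\in\mathbb{R}^{l\times p}$, $Y\in\mathbb{R}^{m\times q}$, $Z\in\mathbb{R}^{n\times r}$, $(X,Y,Z)\cdot\mathcal{C}\in\mathbb{R}^{l\times m\times n}$ has entries $\sum_{\alpha,\beta,\gamma}x_{i\alpha}y_{j\beta}z_{k\gamma}c_{\alpha\beta\gamma}$. For $\mathcal{A}\in\mathbb{R}^{l\times m\times n}$ and $u\in\mathbb{R}^l$, $v\in\mathbb{R}^m$, $w\in\mathbb{R}^n$, define the vectors $\mathcal{A}\cdot(v,w)_{2,3}\in\mathbb{R}^l$, $\mathcal{A}\cdot(u,w)_{1,3}\in\mathbb{R}^m$, $\mathcal{A}\cdot(u,v)_{1,2}\in\mathbb{R}^n$ by $$(\mathcal{A}\cdot(v,w)_{2,3})_i=\sum_{j,k}a_{ijk}v_jw_k,\quad (\mathcal{A}\cdot(u,w)_{1,3})_j=\sum_{i,k}a_{ijk}u_iw_k,\quad (\mathcal{A}\cdot(u,v)_{1,2})_k=\sum_{i,j}a_{ijk}u_iv_j.$$ Multilinear rank: $\operatorname{rank}(\mathcal{A})=(p,q,r)$ means that the spans of the mode-1 fibres $\mathcal{A}(:,j,k)$, of the mode-2 fibres $\mathcal{A}(i,:,k)$ and of the mode-3 fibres $\mathcal{A}(i,j,:)$ have dimensions $p$, $q$, $r$ respectively. Minimal Krylov recursion (in exact arithmetic):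 given unit vectors $u_1\in\mathbb{R}^l$, $v_1\in\mathbb{R}^m$, set $\alpha_w w_1=\mathcal{A}\cdot(u_1,v_1)_{1,2}$. With $U_i=[u_1\,\cdots\,u_i]$, $V_i=[v_1\,\cdots\,v_i]$, $W_i=[w_1\,\cdots\,w_i]$, for $i=1,2,\dots,k-1$ compute in order: (1) $\widehat u=\mathcal{A}\cdot(v_i,w_i)_{2,3}$ and $\alpha_u u_{i+1}=\widehat u-U_iU_i^{\mathsf T}\widehat u$; (2) $\widehat v=\mathcal{A}\cdot(u_{i+1},w_i)_{1,3}$ and $\alpha_v v_{i+1}=\widehat v-V_iV_i^{\mathsf T}\widehat v$; (3) $\widehat w=\mathcal{A}\cdot(u_{i+1},v_{i+1})_{1,2}$ and $\alpha_w w_{i+1}=\widehat w-W_iW_i^{\mathsf T}\widehat w$. The scalars $\alpha_u,\alpha_v,\alpha_w$ (depending on $i$) are chosen so that the generated vectors have length one. Running it for $r$ iterations means generating $u_1,\dots,u_r$, $v_1,\dots,v_r$, $w_1,\dots,w_r$ (i.e. $k=r$). The process does not break down if each newly generated vector ($\widehat u$, $\widehat v$, $\widehat w$, and $\mathcal{A}\cdot(u_1,v_1)_{1,2}$) is not a linear combination of the previously generated vectors in its mode (in particular it is nonzero), so that all normalizations are possible. *)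

(* Defs.v *)
From mathcomp Require Import all_boot all_order all_algebra.
From mathcomp Require Import reals.

Set Implicit Arguments.
Unset Strict Implicit.
Unset Printing Implicit Defensive.

Import Order.TTheory GRing.Theory Num.Theory.

Local Open Scope ring_scope.

Definition tensor (R : Type) (l m n : nat) := {ffun 'I_l * 'I_m * 'I_n -> R}.

Definition tmul (R : realType) (l m n p q r : nat)
    (X : 'M[R]_(l, p)) (Y : 'M[R]_(m, q)) (Z : 'M[R]_(n, r))
    (C : tensor R p q r) : tensor R l m n :=
  [ffun t => \sum_(a < p) \sum_(b < q) \sum_(c < r)
     X t.1.1 a * Y t.1.2 b * Z t.2 c * C (a, b, c)].

Definition contract23 (R : realType) (l m n : nat) (A : tensor R l m n)
    (v : 'cV[R]_m) (w : 'cV[R]_n) : 'cV[R]_l :=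
  \col_(i < l) \sum_(j < m) \sum_(k < n) A (i, j, k) * v j 0 * w k 0.

Definition contract13 (R : realType) (l m n : nat) (A : tensor R l m n)
    (u : 'cV[R]_l) (w : 'cV[R]_n) : 'cV[R]_m :=
  \col_(j < m) \sum_(i < l) \sum_(k < n) A (i, j, k) * u i 0 * w k 0.

Definition contract12 (R : realType) (l m n : nat) (A : tensor R l m n)
    (u : 'cV[R]_l) (v : 'cV[R]_m) : 'cV[R]_n :=
  \col_(k < n) \sum_(i < l) \sum_(j < m) A (i, j, k) * u i 0 * v j 0.

Definition colspan (R : realType) (p q : nat) (M : 'M[R]_(p, q)) :
    {vspace 'cV[R]_p} :=
  <<[seq col j M | j : 'I_q]>>%VS.

Definition fibre1 (R : realType) (l m n : nat) (A : tensor R l m n)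
    (j : 'I_m) (k : 'I_n) : 'cV[R]_l := \col_i A (i, j, k).

Definition fibre2 (R : realType) (l m n : nat) (A : tensor R l m n)
    (i : 'I_l) (k : 'I_n) : 'cV[R]_m := \col_j A (i, j, k).

Definition fibre3 (R : realType) (l m n : nat) (A : tensor R l m n)
    (i : 'I_l) (j : 'I_m) : 'cV[R]_n := \col_k A (i, j, k).

Definition multilinear_rank (R : realType) (l m n : nat) (A : tensor R l m n) :
    nat * nat * nat :=
  (\dim <<[seq fibre1 A t.1 t.2 | t : 'I_m * 'I_n]>>%VS,
   \dim <<[seq fibre2 A t.1 t.2 | t : 'I_l * 'I_n]>>%VS,
   \dim <<[seq fibre3 A t.1 t.2 | t : 'I_l * 'I_m]>>%VS).

(* Euclidean length; the norm that MathComp-Analysis puts on matrices is the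
   max norm. *)
Definition vlength (R : realType) (p : nat) (x : 'cV[R]_p) : R :=
  Num.sqrt (\sum_(i < p) x i 0 ^+ 2).

(* Sequences of vectors are indexed from 0, so that [x 0] is the starting
   vector x_1 and [cols x i] is the matrix [x_1 ... x_i]. *)
Definition cols (R : realType) (p : nat) (x : nat -> 'cV[R]_p) (i : nat) :
    'M[R]_(p, i) :=
  \matrix_(a < p, b < i) x b a 0.

(* [y] is the result of orthogonalizing [xhat] against the columns of [M] and
   normalizing; the sign of the scalar is not prescribed. *)
Definition orthonormalizes (R : realType) (p q : nat) (M : 'M[R]_(p, q))
    (xhat y : 'cV[R]_p) : Prop :=
  vlength y = 1 /\ exists alpha : R, alpha *: y = xhat - M *m M^T *m xhat.

(* [u], [v], [w] record, up to index [k] (excluded), a run of the minimal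
   Krylov recursion; later terms are unconstrained. *)
Definition min_krylov (R : realType) (l m n : nat) (A : tensor R l m n)
    (u : nat -> 'cV[R]_l) (v : nat -> 'cV[R]_m) (w : nat -> 'cV[R]_n)
    (k : nat) : Prop :=
  [/\ vlength (u 0%N) = 1,
      vlength (v 0%N) = 1,
      vlength (w 0%N) = 1 /\
        (exists alpha : R, alpha *: w 0%N = contract12 A (u 0%N) (v 0%N))
    & forall i : nat, (i.+1 < k)%N ->
      [/\ orthonormalizes (cols u i.+1) (contract23 A (v i) (w i)) (u i.+1),
          orthonormalizes (cols v i.+1) (contract13 A (u i.+1) (w i)) (v i.+1)
        & orthonormalizes (cols w i.+1) (contract12 A (u i.+1) (v i.+1))
            (w i.+1)]].

Definition no_breakdown (R : realType) (l m n : nat) (A : tensor R l m n)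
    (u : nat -> 'cV[R]_l) (v : nat -> 'cV[R]_m) (w : nat -> 'cV[R]_n)
    (k : nat) : Prop :=
  contract12 A (u 0%N) (v 0%N) \notin colspan (cols w 0) /\
  forall i : nat, (i.+1 < k)%N ->
    [/\ contract23 A (v i) (w i) \notin colspan (cols u i.+1),
        contract13 A (u i.+1) (w i) \notin colspan (cols v i.+1)
      & contract12 A (u i.+1) (v i.+1) \notin colspan (cols w i.+1)].

(* Main.v *)
Require Import Defs.
From mathcomp Require Import all_boot all_order all_algebra.
From mathcomp Require Import reals.
From mathcomp Require Import ring.

(* Orthogonality of the generated vectors plays no role: a vector that is not in
   the span of its predecessors stays outside it after the projection onto that
   span is subtracted, so every step raises the dimension of the span by one.
   Every contraction of A is a combination of fibres of A, hence lies in the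
   range of X, Y or Z; that range has dimension at most r, and r steps fill it. *)

Import GRing.Theory.

Local Open Scope ring_scope.

Lemma mulmx_colspan (R : realType) (p q : nat) (M : 'M[R]_(p, q))
    (c : 'cV[R]_q) : M *m c \in colspan M.
Proof.
have -> : M *m c = \sum_(j < q) c j 0 *: col j M.
  apply/colP => i; rewrite !mxE summxE; apply: eq_bigr => j _.
  by rewrite !mxE mulrC.
by apply: memv_suml => j _; rewrite memvZ // memv_span // image_f.
Qed.

Lemma dim_colspan (R : realType) (p q : nat) (M : 'M[R]_(p, q)) :
  (\dim (colspan M) <= q)%N.
Proof.
by apply: leq_trans (dim_span _) _; rewrite size_image card_ord.
Qed.

(** The width of [cols x i] depends on [i]; over [iota], adjoining the next vector becomes list
    concatenation. *)
Lemma colspan_cols (R : realType) (p : nat) (x : nat -> 'cV[R]_p) (i : nat) :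
  colspan (cols x i) = <<[seq x j | j <- iota 0 i]>>%VS.
Proof.
rewrite /colspan -val_enum_ord -map_comp /image_mem; congr (<<_>>%VS).
by apply: eq_map => j; apply/colP => a; rewrite !mxE.
Qed.

Lemma colspan_colsS (R : realType) (p : nat) (x : nat -> 'cV[R]_p) (i : nat) :
  colspan (cols x i.+1)
    = (colspan (cols x i) + <[x i]>)%VS.
Proof. by rewrite !colspan_cols -[i.+1]addn1 iotaD map_cat span_cat span_seq1. Qed.

(** The line through [y] meets [S] only in 0: if [c *: y] is in [S] with [c] nonzero, dividing by
    [c] puts [y] in [S]. *)
Lemma dim_addv_line (K : fieldType) (E : vectType K) (S : {vspace E}) (y : E) :
  y \notin S -> \dim (S + <[y]>)%VS = (\dim S).+1.
Proof.
move=> yS; rewrite dimv_disjoint_sum.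
  by rewrite dim_vline; case: eqP yS => [->|_ _]; rewrite ?mem0v // addn1.
apply/eqP; rewrite -subv0; apply/subvP => z /memv_capP [zS /vlineP [c def_z]].
rewrite memv0 def_z; case: (eqVneq c 0) => [->|c0]; first by rewrite scale0r.
by case/negP: yS; rewrite -[y](scalerK c0) -def_z memvZ.
Qed.

Lemma vlength0 (R : realType) (p : nat) : vlength (0 : 'cV[R]_p) = 0.
Proof.
by rewrite /vlength big1 ?Num.Theory.sqrtr0 // => i _; rewrite mxE expr0n.
Qed.

(** Since [xhat = a *: y + M *m M^T *m xhat], having [y] in the span would put [xhat] there too. *)
Lemma orthonormalizes_notin (R : realType) (p q : nat) (M : 'M[R]_(p, q))
    (xhat y : 'cV[R]_p) :
  orthonormalizes M xhat y -> xhat \notin colspan M ->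
  y \notin colspan M.
Proof.
case=> _ [a def_y]; apply: contra => yM.
rewrite -(subrK (M *m M^T *m xhat) xhat) -def_y.
by rewrite memvD ?memvZ // -mulmxA mulmx_colspan.
Qed.

(** Solving for [y] requires dividing by [a]. If [a] were 0, [xhat] would equal [M *m M^T *m xhat]
    and lie in the span of [M]. *)
Lemma orthonormalizes_mem (R : realType) (p q : nat) (M : 'M[R]_(p, q))
    (xhat y : 'cV[R]_p) (S : {vspace 'cV[R]_p}) :
  orthonormalizes M xhat y -> xhat \notin colspan M ->
  (colspan M <= S)%VS -> xhat \in S -> y \in S.
Proof.
case=> _ [a def_y] xM MS xS.
have a0 : a != 0.
  apply: contraNneq xM => a0; move: def_y; rewrite a0 scale0r => /esym/eqP.
  by rewrite subr_eq0 => /eqP ->; rewrite -mulmxA mulmx_colspan.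
rewrite -[y](scalerK a0) def_y memvZ // memvB //.
by apply: (subvP MS); rewrite -mulmxA mulmx_colspan.
Qed.

(** This isolates one mode: the other two enter only through [xhat], an arbitrary sequence in [S],
    so the coupling between modes disappears. By induction the first [i] vectors span an
    [i]-dimensional subspace of [S]; at [i = k] the bound on [\dim S] forces equality. *)
Lemma krylov_fills (R : realType) (p k : nat) (x xhat : nat -> 'cV[R]_p)
    (S : {vspace 'cV[R]_p}) :
  (\dim S <= k)%N -> vlength (x 0%N) = 1 -> x 0%N \in S ->
  (forall i, xhat i \in S) ->
  (forall i, (i.+1 < k)%N ->
     orthonormalizes (cols x i.+1) (xhat i) (x i.+1)
     /\ xhat i \notin colspan (cols x i.+1)) ->
  colspan (cols x k) = S.
Proof.
move=> dimS x0 x0S xhatS step.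
suff H i : (i <= k)%N ->
    (colspan (cols x i) <= S)%VS
    /\ \dim (colspan (cols x i)) = i.
  by have [sub dimk] := H k (leqnn k); apply/eqP; rewrite eqEdim sub dimk.
elim: i => [_|i IHi lt_ik].
  by rewrite colspan_cols /= span_nil sub0v dimv0.
have [sub dimi] := IHi (ltnW lt_ik).
have [xiS xiN] : x i \in S /\ x i \notin colspan (cols x i).
  (* The starting vector comes from no orthogonalization step: its predecessors span 0, and unit
     length makes it nonzero. *)
  case: i lt_ik sub {IHi dimi} => [|i] lt_ik sub.
    split=> //; rewrite colspan_cols /= span_nil memv0.
    apply/eqP => x00; move: x0; rewrite x00 vlength0 => /esym/eqP.
    by rewrite oner_eq0.
  have [orth xN] := step i lt_ik; split.
    exact: orthonormalizes_mem orth xN sub (xhatS i).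
  exact: orthonormalizes_notin orth xN.
by rewrite colspan_colsS dim_addv_line // dimi subv_add sub -memvE.
Qed.

(** The fibre at [(j, k)] is [X] applied to the contraction of [C] with row [j] of [Y] and row [k]
    of [Z]. *)
Lemma contract23_tmul (R : realType) (l m n p q r : nat)
    (X : 'M[R]_(l, p)) (Y : 'M[R]_(m, q)) (Z : 'M[R]_(n, r))
    (C : tensor R p q r) (v : 'cV[R]_m) (w : 'cV[R]_n) :
  contract23 (tmul X Y Z C) v w \in colspan X.
Proof.
set A := tmul X Y Z C.
have -> : contract23 A v w
    = \sum_j \sum_k (v j 0 * w k 0) *: fibre1 A j k.
  apply/colP => i; rewrite !mxE summxE; apply: eq_bigr => j _.
  by rewrite summxE; apply: eq_bigr => k _; rewrite !mxE; ring.
apply: memv_suml => j _; apply: memv_suml => k _; apply: memvZ.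
have -> : fibre1 A j k
    = X *m \col_a \sum_b \sum_c Y j b * Z k c * C (a, b, c).
  apply/colP => i; rewrite !mxE ffunE /=; apply: eq_bigr => a _.
  rewrite mxE mulr_sumr; apply: eq_bigr => b _.
  by rewrite mulr_sumr; apply: eq_bigr => c _; ring.
exact: mulmx_colspan.
Qed.

Lemma contract13_tmul (R : realType) (l m n p q r : nat)
    (X : 'M[R]_(l, p)) (Y : 'M[R]_(m, q)) (Z : 'M[R]_(n, r))
    (C : tensor R p q r) (u : 'cV[R]_l) (w : 'cV[R]_n) :
  contract13 (tmul X Y Z C) u w \in colspan Y.
Proof.
set A := tmul X Y Z C.
have -> : contract13 A u w
    = \sum_i \sum_k (u i 0 * w k 0) *: fibre2 A i k.
  apply/colP => j; rewrite !mxE summxE; apply: eq_bigr => i _.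
  by rewrite summxE; apply: eq_bigr => k _; rewrite !mxE; ring.
apply: memv_suml => i _; apply: memv_suml => k _; apply: memvZ.
have -> : fibre2 A i k
    = Y *m \col_b \sum_a \sum_c X i a * Z k c * C (a, b, c).
  apply/colP => j; rewrite !mxE ffunE /= exchange_big; apply: eq_bigr => b _.
  rewrite mxE mulr_sumr; apply: eq_bigr => a _.
  by rewrite mulr_sumr; apply: eq_bigr => c _; ring.
exact: mulmx_colspan.
Qed.

Lemma contract12_tmul (R : realType) (l m n p q r : nat)
    (X : 'M[R]_(l, p)) (Y : 'M[R]_(m, q)) (Z : 'M[R]_(n, r))
    (C : tensor R p q r) (u : 'cV[R]_l) (v : 'cV[R]_m) :
  contract12 (tmul X Y Z C) u v \in colspan Z.
Proof.
set A := tmul X Y Z C.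
have -> : contract12 A u v
    = \sum_i \sum_j (u i 0 * v j 0) *: fibre3 A i j.
  apply/colP => k; rewrite !mxE summxE; apply: eq_bigr => i _.
  by rewrite summxE; apply: eq_bigr => j _; rewrite !mxE; ring.
apply: memv_suml => i _; apply: memv_suml => j _; apply: memvZ.
have -> : fibre3 A i j
    = Z *m \col_c \sum_a \sum_b X i a * Y j b * C (a, b, c).
  apply/colP => k; rewrite !mxE ffunE /=.
  (* [tmul] sums over [c] innermost, the product with [Z] outermost; one exchange on each side
     brings both to the order [a], [c], [b]. *)
  under [RHS]eq_bigr => c _ do rewrite mxE mulr_sumr.
  rewrite [RHS]exchange_big; apply: eq_bigr => a _ /=.
  rewrite exchange_big; apply: eq_bigr => c _ /=.
  by rewrite mulr_sumr; apply: eq_bigr => b _; ring.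
exact: mulmx_colspan.
Qed.

Theorem theorem2 (R : realType) (l m n r : nat)
    (A : tensor R l m n) (C : tensor R r r r)
    (X : 'M[R]_(l, r)) (Y : 'M[R]_(m, r)) (Z : 'M[R]_(n, r))
    (u : nat -> 'cV[R]_l) (v : nat -> 'cV[R]_m) (w : nat -> 'cV[R]_n)
    (hA : A = tmul X Y Z C)
    (hrank : multilinear_rank A = (r, r, r))
    (hX : \rank X = r) (hY : \rank Y = r) (hZ : \rank Z = r)
    (hu1 : u 0%N \in colspan X)
    (hv1 : v 0%N \in colspan Y)
    (hw1 : w 0%N \in colspan Z)
    (hrun : min_krylov A u v w r)
    (hnb : no_breakdown A u v w r) :
  [/\ colspan (cols u r) = colspan X,
      colspan (cols v r) = colspan Y
    & colspan (cols w r) = colspan Z].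
Proof.
case: hrun => lu lv [lw _] steps; case: hnb => _ nb; subst A.
split.
(* Contractions lie in the range of the factor for all arguments, so [xhat] may be defined at every
   index, even beyond the run. *)
- apply: (krylov_fills R _ r _ (fun i => contract23 (tmul X Y Z C) (v i) (w i)))
    => [||//|i|i /[dup] /steps [? _ _] /nb [? _ _]] //.
  + exact: dim_colspan.
  + exact: contract23_tmul.
(* The shifted index reflects that the vector of mode 1 just generated is already used within the
   same iteration. *)
- apply: (krylov_fills R _ r _ (fun i => contract13 (tmul X Y Z C) (u i.+1) (w i)))
    => [||//|i|i /[dup] /steps [_ ? _] /nb [_ ? _]] //.
  + exact: dim_colspan.
  + exact: contract13_tmul.
- apply: (krylov_fills R _ r _ (fun i => contract12 (tmul X Y Z C) (u i.+1) (v i.+1)))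
    => [||//|i|i /[dup] /steps [_ _ ?] /nb [_ _ ?]] //.
  + exact: dim_colspan.
  + exact: contract12_tmul.
Qed.
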